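(* Let $n\ge2$, let $\tau_1,\dots,\tau_{n!}$ be the enumeration $S_n$ of simple $n$-braids defined below, and let $M_n$ be the $n!\times n!$ matrix with $(M_n)_{k,\ell}=1$ if $(\tau_k,\tau_\ell)$ is normal and $0$ otherwise. Then: (i) the first column and the last row of $M_n$ contain only $1$'s; the first row, except its first entry, and the last column, except its last entry, contain only $0$'s; (ii) the first $(n-1)!$ columns of $M_n$ consist of $n$ stacked copies of $M_{n-1}$; (iii) if $D_R(\tau_k)=D_R(\tau_{k'})$, then the $k$-th and $k'$-th rows of $M_n$ coincide; if $D_L(\tau_\ell)=D_L(\tau_{\ell'})$, then the $\ell$-th and $\ell'$-th columns of $M_n$ coincide.
   Context: $B_n^+$ is the positive braid monoid with generators $\sigma_1,\dots,\sigma_{n-1}$ and relations $\sigma_i\sigma_j=\sigma_j\sigma_i$ ($|i-j|\ge2$), $\sigma_i\sigma_j\sigma_i=\sigma_j\sigma_i\sigma_j$ ($|i-j|=1$). $\Delta_1=1$, $\Delta_m=\sigma_1\cdots\sigma_{m-1}\Delta_{m-1}$. Simple $m$-braids are the left (equivalently right) divisors of $\Delta_m$ in $B_m^+$. For simple $x$, $D_L(x)$ (resp. $D_R(x)$) is the set of $i$ with $\sigma_i$ a left (resp. right) divisor of $x$. A pair $(x,y)$ of simple $m$-braids is normal if $x=\gcd(\Delta_m,xy)$ (greatest common left divisor); equivalently $D_R(x)\supseteq D_L(y)$. With $\sigma_{i,m}=\sigma_i\sigma_{i+1}\cdots\sigma_{m-1}$ ($\sigma_{m,m}=1$), the list $S_m$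 of simple $m$-braids is defined by $S_1=(1)$ and $S_m=S_{m-1}{}^\frown\sigma_{m-1,m}S_{m-1}{}^\frown\cdots{}^\frown\sigma_{1,m}S_{m-1}$, where ${}^\frown$ is list concatenation and $xS$ is the list obtained by left-multiplying every entry of $S$ by $x$. Each $S_{m-1}$ is an initial segment of $S_m$; $\tau_k$ denotes the $k$-th entry, and $M_{n-1}$ is defined like $M_n$ from $S_{n-1}$ with normality in $B_{n-1}^+$. *)

(* Defs.v *)
(* MathComp (boot) world. Positive braid monoid B_n^+ modelled as words over
   the letters 1..n-1 (letter i = sigma_i) modulo the congruence generated by
   the braid relations. *)
From mathcomp Require Import all_boot.
From Stdlib Require Import ClassicalEpsilon.

Set Implicit Arguments. Unset Strict Implicit. Unset Printing Implicit Defensive.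

Definition word := seq nat.

Definition wf (n : nat) (w : word) : bool := all (fun i => (0 < i) && (i < n)) w.

Inductive beq : word -> word -> Prop :=
| beq_refl w : beq w w
| beq_sym u v : beq u v -> beq v u
| beq_trans u v w : beq u v -> beq v w -> beq u w
| beq_comm (u v : word) (i j : nat) : (i.+1 < j) || (j.+1 < i) ->
    beq (u ++ [:: i; j] ++ v) (u ++ [:: j; i] ++ v)
| beq_braid (u v : word) (i j : nat) : (i.+1 == j) || (j.+1 == i) ->
    beq (u ++ [:: i; j; i] ++ v) (u ++ [:: j; i; j] ++ v).

Definition ldiv (n : nat) (x z : word) : Prop := exists w, wf n w /\ beq (x ++ w) z.
Definition rdiv (n : nat) (x z : word) : Prop := exists w, wf n w /\ beq (w ++ x) z.

Definition sig (i m : nat) : word := iota i (m - i).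

Fixpoint Delta (m : nat) : word :=
  match m with
  | 0 => [::]
  | m'.+1 => sig 1 m'.+1 ++ Delta m'
  end.

Definition DL (n : nat) (x : word) (i : nat) : Prop := 0 < i < n /\ ldiv n [:: i] x.
Definition DR (n : nat) (x : word) (i : nat) : Prop := 0 < i < n /\ rdiv n [:: i] x.

(* (x,y) normal : x = gcd(Delta_n, x y) (greatest common left divisor) *)
Definition normal (n : nat) (x y : word) : Prop :=
  [/\ ldiv n x (Delta n), ldiv n x (x ++ y) &
      forall z, wf n z -> ldiv n z (Delta n) -> ldiv n z (x ++ y) -> ldiv n z x].

(* The list S_m: S_1 = (1), S_m = S_{m-1} ^ sigma_{m-1,m} S_{m-1} ^ ... ^ sigma_{1,m} S_{m-1}
   (the first block is sigma_{m,m} S_{m-1} = S_{m-1}). *)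
Fixpoint Slist (m : nat) : seq word :=
  match m with
  | 0 => [::]
  | 1 => [:: [::]]
  | m'.+1 => flatten [seq [seq sig i m'.+1 ++ s | s <- Slist m'] | i <- rev (iota 1 m'.+1)]
  end.

(* tau_k (0-based index k: tau k corresponds to the paper's tau_{k+1}) *)
Definition tau (m k : nat) : word := nth [::] (Slist m) k.

Definition Mentry (m k l : nat) : nat :=
  if excluded_middle_informative (normal m (tau m k) (tau m l)) then 1 else 0.

(* Main.v *)
Require Import Defs.
From mathcomp Require Import all_boot zify.
From Stdlib Require Import ClassicalEpsilon.

Set Implicit Arguments. Unset Strict Implicit. Unset Printing Implicit Defensive.

(* Positive braid words are compared with the permutations of {1, ..., n}
   they induce.  A word is reduced when its length is the number of
   inversions of its permutation; the exchange property and Matsumoto's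
   theorem show that reduced words with the same permutation are equal in
   B_n^+, that they are exactly the left divisors of Delta_n, and that
   sigma_i right-divides such a word iff its permutation has a descent at i.
   Left cancellativity and the existence of common multiples, obtained by
   word reversing, then give the normality criterion: for simple x and y,
   (x, y) is normal iff D_L(y) is contained in D_R(x).  Part (iii) is
   immediate from it, part (i) follows from tau_1 = 1 and tau_{n!} = Delta_n,
   and part (ii) from the block structure of S_n: left multiplication by
   sigma_{j,n} is increasing on {1, ..., n-1}, so it does not change the
   right descents below n - 1. *)

Lemma beq_catl p u v : beq u v -> beq (p ++ u) (p ++ v).
Proof.
elim=> {u v} [w|u v _ IH|u v w _ IH1 _ IH2|u v i j h|u v i j h].
- exact: beq_refl.
- exact: beq_sym.
- exact: beq_trans IH2.
- rewrite !(catA p); exact: beq_comm.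
- rewrite !(catA p); exact: beq_braid.
Qed.

Lemma beq_catr s u v : beq u v -> beq (u ++ s) (v ++ s).
Proof.
elim=> {u v} [w|u v _ IH|u v w _ IH1 _ IH2|u v i j h|u v i j h].
- exact: beq_refl.
- exact: beq_sym.
- exact: beq_trans IH2.
- rewrite -!catA /=; exact: beq_comm.
- rewrite -!catA /=; exact: beq_braid.
Qed.

Lemma beq_cons a u v : beq u v -> beq (a :: u) (a :: v).
Proof. exact: (beq_catl [:: a]). Qed.

Lemma beq_size u v : beq u v -> size u = size v.
Proof.
by elim=> {u v} [w|u v _ ->|u v w _ -> _ ->|u v i j _|u v i j _] //; rewrite !size_cat.
Qed.

Lemma beq_all (P : pred nat) u v : beq u v -> all P u = all P v.
Proof.
elim=> {u v} [w|u v _ ->|u v w _ -> _ ->|u v i j _|u v i j _] //;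
rewrite !all_cat /=; do ! case: (P _) => //=.
Qed.

Lemma beq_wf n u v : beq u v -> wf n u = wf n v.
Proof. exact: beq_all. Qed.

Definition far (i j : nat) := (i.+1 < j) || (j.+1 < i).
Definition adjacent (i j : nat) := (i.+1 == j) || (j.+1 == i).

Lemma farC i j : far i j = far j i.
Proof. by rewrite /far orbC. Qed.

Lemma adjacentC i j : adjacent i j = adjacent j i.
Proof. by rewrite /adjacent orbC. Qed.

Lemma far_neq i j : far i j -> (i == j) = false.
Proof. by rewrite /far => h; apply/eqP; lia. Qed.

Lemma adjacent_neq i j : adjacent i j -> (i == j) = false.
Proof. by rewrite /adjacent => h; apply/eqP; lia. Qed.

Lemma adjacent_not_far i j : adjacent i j -> far i j = false.
Proof. by rewrite /adjacent /far => h; apply/negbTE; lia. Qed.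

Lemma adjacent_of_not_far i j : i != j -> far i j = false -> adjacent i j.
Proof. by rewrite /adjacent /far; lia. Qed.

Lemma beq_far u v i j : far i j -> beq (u ++ i :: j :: v) (u ++ j :: i :: v).
Proof. exact: beq_comm. Qed.

Lemma beq_adjacent u v i j :
  adjacent i j -> beq (u ++ i :: j :: i :: v) (u ++ j :: i :: j :: v).
Proof. exact: beq_braid. Qed.

Lemma beq_far0 v i j : far i j -> beq (i :: j :: v) (j :: i :: v).
Proof. exact: (beq_far [::]). Qed.

Lemma beq_adjacent0 v i j : adjacent i j -> beq (i :: j :: i :: v) (j :: i :: j :: v).
Proof. exact: (beq_adjacent [::]). Qed.

(* [lquo i w] pushes the letter [i] rightwards through [w] until it meets a
   copy of itself: past a far letter [j] by commutation, past an adjacent one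
   by [i j i = j i j], which requires extracting [i] and then [j] from the
   rest.  The fuel only ensures termination, [size w] always suffices. *)
Fixpoint lquo_fuel (f i : nat) (w : word) : option word :=
  if f is f'.+1 then
    if w is j :: v then
      if i == j then Some v
      else if far i j then omap (cons j) (lquo_fuel f' i v)
      else obind (fun r => omap (fun t => j :: i :: t) (lquo_fuel f' j r))
             (lquo_fuel f' i v)
    else None
  else None.

Definition lquo i w := lquo_fuel (size w) i w.

Lemma lquo_fuel_size f i w r : lquo_fuel f i w = Some r -> size w = (size r).+1.
Proof.
elim: f i w r => [|f IH] i [|j v] r //=.
case: eqP => [_ [<-] //|_].
case: ifP => _.
  by case E: (lquo_fuel f i v) => [r'|] //= [<-] /=; rewrite (IH _ _ _ E).
case E: (lquo_fuel f i v) => [r'|] //=.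
case E2: (lquo_fuel f j r') => [t|] //= [<-] /=.
by rewrite (IH _ _ _ E) (IH _ _ _ E2).
Qed.

Lemma lquo_fuel_enough f g i w :
  size w <= f -> size w <= g -> lquo_fuel f i w = lquo_fuel g i w.
Proof.
elim: f g i w => [|f IH] [|g] i [|j v] //= hf hg.
case: eqP => // _; rewrite (IH g i v) //; case: ifP => // _.
case E: (lquo_fuel g i v) => [r|] //=.
have hr := lquo_fuel_size E.
by rewrite (IH g j r) //; move: hf hg; rewrite /= hr; lia.
Qed.

Lemma lquo_size i w r : lquo i w = Some r -> size w = (size r).+1.
Proof. exact: lquo_fuel_size. Qed.

Lemma lquo_cons i j v : lquo i (j :: v) =
  if i == j then Some v
  else if far i j then omap (cons j) (lquo i v)
  else obind (fun r => omap (fun t => j :: i :: t) (lquo j r)) (lquo i v).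
Proof.
rewrite /lquo /=; case: eqP => // _; case: ifP => // _.
case E: (lquo_fuel (size v) i v) => [r|] //=.
by rewrite (@lquo_fuel_enough (size v) (size r)) // (lquo_fuel_size E).
Qed.

Lemma lquo_eq i v : lquo i (i :: v) = Some v.
Proof. by rewrite lquo_cons eqxx. Qed.

Lemma lquo_far i j v : far i j -> lquo i (j :: v) = omap (cons j) (lquo i v).
Proof. by move=> h; rewrite lquo_cons (far_neq h) h. Qed.

Lemma lquo_adjacent i j v : adjacent i j ->
  lquo i (j :: v) = obind (fun r => omap (fun t => j :: i :: t) (lquo j r)) (lquo i v).
Proof. by move=> h; rewrite lquo_cons (adjacent_neq h) (adjacent_not_far h). Qed.

Lemma lquo_sound i w r : lquo i w = Some r -> beq w (i :: r).
Proof.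
elim: {w}(size w) {-2}w (leqnn (size w)) i r => [|m IH] [|j v] // hs i r.
rewrite lquo_cons; case: eqP => [-> [<-]|ne]; first exact: beq_refl.
case: ifP => hf.
  case E: (lquo i v) => [r'|] //= [<-].
  apply: beq_trans (beq_cons _ (IH _ hs _ _ E)) _.
  by apply: beq_far0; rewrite farC.
have ha : adjacent j i by rewrite adjacentC; apply: adjacent_of_not_far => //; apply/eqP.
case E: (lquo i v) => [r1|] //=; case E2: (lquo j r1) => [t|] //= [<-].
have hs1 : size r1 <= m by have := lquo_size E; move: hs => /=; lia.
apply: beq_trans (beq_cons _ (beq_trans (IH _ hs _ _ E) (beq_cons _ (IH _ hs1 _ _ E2)))) _.
exact: beq_adjacent0.
Qed.

Definition obeq (o1 o2 : option word) :=
  match o1, o2 with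
  | Some a, Some b => beq a b
  | None, None => True
  | _, _ => False
  end.

(* The cases of the compatibility of [lquo] with the braid relations are
   proved in this one-sided form; the converse is the same case with the two
   sides swapped. *)
Definition obeq_le (o1 o2 : option word) :=
  forall x, o1 = Some x -> exists2 y, o2 = Some y & beq x y.

Lemma obeq_of_le o1 o2 : obeq_le o1 o2 -> obeq_le o2 o1 -> obeq o1 o2.
Proof.
case: o1 => [a|]; case: o2 => [b|] //= h1 h2.
- by have [y [<-]] := h1 a erefl.
- by have [y] := h1 a erefl.
- by have [y] := h2 b erefl.
Qed.

Lemma obeq_refl o : obeq o o.
Proof. by case: o => //= a; exact: beq_refl. Qed.

Lemma obeq_sym o1 o2 : obeq o1 o2 -> obeq o2 o1.
Proof. by case: o1 => [a|]; case: o2 => [b|] //=; exact: beq_sym. Qed.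

Lemma obeq_trans o1 o2 o3 : obeq o1 o2 -> obeq o2 o3 -> obeq o1 o3.
Proof. by case: o1 => [a|]; case: o2 => [b|]; case: o3 => [c|] //=; exact: beq_trans. Qed.

Lemma obeq_omap f o1 o2 : (forall a b, beq a b -> beq (f a) (f b)) ->
  obeq o1 o2 -> obeq (omap f o1) (omap f o2).
Proof. by move=> hf; case: o1 => [a|]; case: o2 => [b|] //=; apply: hf. Qed.

Definition lquo_beq_below (S : nat) :=
  forall u v, size u < S -> beq u v -> forall i, obeq (lquo i u) (lquo i v).

Lemma lquo_beq_below_Some S k u u' x : lquo_beq_below S -> size u < S -> beq u u' ->
  lquo k u' = Some x -> exists2 y, lquo k u = Some y & beq y x.
Proof.
move=> H hs e hx; have := H _ _ hs e k; rewrite hx.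
by case: (lquo k u) => [y|] //= hy; exists y.
Qed.

(* Both sides extract [a] and [b] in a different order: the intermediate
   words only agree up to [beq], so the compatibility for shorter words is
   what makes the two results comparable. *)
Lemma lquo_far_adjacent2_le S a b v i : lquo_beq_below S -> size (a :: b :: v) <= S ->
  far a b -> adjacent i a -> adjacent i b ->
  obeq_le (lquo i (a :: b :: v)) (lquo i (b :: a :: v)).
Proof.
move=> H hS hab Aia Aib x.
have hba : far b a by rewrite farC.
have Aai : adjacent a i by rewrite adjacentC.
have Abi : adjacent b i by rewrite adjacentC.
rewrite (lquo_adjacent _ Aia) (lquo_adjacent _ Aib).
case E: (lquo i v) => [r|] //=; case E2: (lquo b r) => [s|] //=.
rewrite (lquo_far _ hab) (lquo_adjacent _ Aai).
case E3: (lquo a s) => [t|] //=; case E4: (lquo i t) => [q|] //= [<-].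
have sz := lquo_size E; have sz2 := lquo_size E2.
have sz3 := lquo_size E3; have sz4 := lquo_size E4.
have er : beq r (a :: b :: i :: q).
  apply: beq_trans (lquo_sound E2) _.
  apply: beq_trans (beq_cons _ (lquo_sound E3)) _.
  apply: beq_trans (beq_cons _ (beq_cons _ (lquo_sound E4))) _.
  exact: beq_far0.
have l1 : size r < S by move: hS => /=; lia.
have [s' E5 e5] := lquo_beq_below_Some H l1 er (lquo_eq _ _).
rewrite (lquo_adjacent _ Aib) (lquo_adjacent _ Aia) E /= E5 /=.
rewrite (lquo_far _ hba) (lquo_adjacent _ Abi).
have sz5 := lquo_size E5.
have l2 : size s' < S by move: hS => /=; lia.
have [t' E6 e6] := lquo_beq_below_Some H l2 e5 (lquo_eq _ _).
rewrite E6 /=; have sz6 := lquo_size E6.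
have l3 : size t' < S by move: hS => /=; lia.
have [q' E7 e7] := lquo_beq_below_Some H l3 e6 (lquo_eq _ _).
rewrite E7 /=; eexists; first reflexivity.
apply: beq_trans (beq_catl [:: b; i; a; i; b] (beq_sym e7)).
apply: beq_trans (beq_adjacent [:: a] _ Aib) _.
apply: beq_trans (beq_far0 _ hab) _.
apply: beq_trans (beq_far [:: b; a; i] _ hba) _.
exact: (beq_adjacent [:: b] _ Aai).
Qed.

Lemma lquo_far_le S a b v i : lquo_beq_below S -> size (a :: b :: v) <= S -> far a b ->
  obeq_le (lquo i (a :: b :: v)) (lquo i (b :: a :: v)).
Proof.
move=> H hS hab x; have hba : far b a by rewrite farC.
case: (eqVneq i a) => [->|nia].
  rewrite lquo_eq (lquo_far _ hab) lquo_eq => -[<-].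
  by exists (b :: v) => //; exact: beq_refl.
case: (eqVneq i b) => [->|nib].
  rewrite (lquo_far _ hba) lquo_eq lquo_eq => -[<-].
  by exists (a :: v) => //; exact: beq_refl.
case Hia: (far i a); case Hib: (far i b).
- rewrite (lquo_far _ Hia) (lquo_far _ Hib) (lquo_far _ Hib) (lquo_far _ Hia).
  case: (lquo i v) => [r|] //= [<-]; eexists; first reflexivity; exact: beq_far0.
- have Aib : adjacent i b by apply: adjacent_of_not_far.
  rewrite (lquo_far _ Hia) (lquo_adjacent _ Aib) (lquo_adjacent _ Aib) (lquo_far _ Hia).
  case: (lquo i v) => [r|] //=; rewrite (lquo_far _ hba).
  case: (lquo b r) => [t|] //= [<-]; eexists; first reflexivity.
  apply: beq_trans (beq_far0 _ hab) _; apply: beq_cons.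
  by apply: beq_far0; rewrite farC.
- have Aia : adjacent i a by apply: adjacent_of_not_far.
  rewrite (lquo_adjacent _ Aia) (lquo_far _ Hib) (lquo_far _ Hib) (lquo_adjacent _ Aia).
  case: (lquo i v) => [r|] //=; rewrite (lquo_far _ hab).
  case: (lquo a r) => [t|] //= [<-]; eexists; first reflexivity.
  apply: beq_trans (beq_far0 _ hab); apply: beq_cons; exact: beq_far0.
- apply: lquo_far_adjacent2_le H hS hab _ _ x; exact: adjacent_of_not_far.
Qed.

Lemma lquo_braid_far_adjacent_le a b v i : adjacent a b -> far i a -> adjacent i b ->
  obeq_le (lquo i (a :: b :: a :: v)) (lquo i (b :: a :: b :: v)).
Proof.
move=> hab Hia Aib x.
have hba : adjacent b a by rewrite adjacentC.
have Hai : far a i by rewrite farC.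
have Abi : adjacent b i by rewrite adjacentC.
rewrite (lquo_far _ Hia) (lquo_adjacent _ Aib) (lquo_far _ Hia).
case E: (lquo i v) => [r|] //=; rewrite (lquo_adjacent _ hba).
case E2: (lquo b r) => [s|] //=; case E3: (lquo a s) => [t|] //= [<-].
rewrite (lquo_adjacent _ Aib) (lquo_far _ Hia) (lquo_adjacent _ Aib) E /= E2 /=.
rewrite (lquo_adjacent _ hba) lquo_eq /= (lquo_far _ Hai) E3 /=.
eexists; first reflexivity.
apply: beq_trans (beq_far [:: a; b] _ Hia) _.
apply: beq_trans (beq_adjacent0 _ hab) _.
apply: beq_trans (beq_adjacent [:: b; a] _ Abi) _.
exact: (beq_far [:: b] _ Hai).
Qed.

Lemma lquo_braid_adjacent_far_le a b v i : adjacent a b -> adjacent i a -> far i b ->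
  obeq_le (lquo i (a :: b :: a :: v)) (lquo i (b :: a :: b :: v)).
Proof.
move=> hab Aia Hib x.
have Hbi : far b i by rewrite farC.
have Aai : adjacent a i by rewrite adjacentC.
rewrite (lquo_adjacent _ Aia) (lquo_far _ Hib) (lquo_adjacent _ Aia).
case E: (lquo i v) => [r|] //=; case E2: (lquo a r) => [s|] //=.
rewrite (lquo_adjacent _ hab) lquo_eq /= (lquo_far _ Hbi).
case E3: (lquo b s) => [t|] //= [<-].
rewrite (lquo_far _ Hib) (lquo_adjacent _ Aia) (lquo_far _ Hib) E /=.
rewrite (lquo_adjacent _ hab) E2 /= E3 /=.
eexists; first reflexivity.
apply: beq_trans (beq_cons _ (beq_far0 _ Hib)) _.
apply: beq_trans (beq_adjacent [:: a; b] _ Aia) _.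
apply: beq_trans (beq_adjacent0 _ hab) _.
exact: (beq_far [:: b; a] _ Hbi).
Qed.

Lemma lquo_braid_le a b v i : adjacent a b ->
  obeq_le (lquo i (a :: b :: a :: v)) (lquo i (b :: a :: b :: v)).
Proof.
move=> hab x; have hba : adjacent b a by rewrite adjacentC.
case: (eqVneq i a) => [->|nia].
  rewrite lquo_eq (lquo_adjacent _ hab) lquo_eq /= lquo_eq /= => -[<-].
  by exists (b :: a :: v) => //; exact: beq_refl.
case: (eqVneq i b) => [->|nib].
  rewrite (lquo_adjacent _ hba) lquo_eq /= lquo_eq lquo_eq /= => -[<-].
  by exists (a :: b :: v) => //; exact: beq_refl.
case Hia: (far i a); case Hib: (far i b).
- rewrite !(lquo_far _ Hia, lquo_far _ Hib).
  case: (lquo i v) => [r|] //= [<-]; eexists; first reflexivity; exact: beq_adjacent0.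
- by apply: lquo_braid_far_adjacent_le => //; apply: adjacent_of_not_far.
- by apply: lquo_braid_adjacent_far_le => //; apply: adjacent_of_not_far.
- have Aia : adjacent i a by apply: adjacent_of_not_far.
  have Aib : adjacent i b by apply: adjacent_of_not_far.
  by exfalso; move: Aia Aib hab nia nib; rewrite /adjacent; lia.
Qed.

Lemma lquo_beq_below_prefix S A B v p : lquo_beq_below S -> size (p ++ A ++ v) <= S ->
  (forall i, obeq (lquo i (A ++ v)) (lquo i (B ++ v))) ->
  (forall q, beq (q ++ A ++ v) (q ++ B ++ v)) ->
  forall i, obeq (lquo i (p ++ A ++ v)) (lquo i (p ++ B ++ v)).
Proof.
move=> H; elim: p => [|x p IH] //= hs hb hq i.
rewrite !lquo_cons; case: eqP => _; first exact: hq.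
have hs' : size (p ++ A ++ v) <= S by apply: leq_trans hs.
case: ifP => _; first by apply: obeq_omap; [exact: beq_cons | exact: IH].
have := IH hs' hb hq i.
case E1: (lquo i (p ++ A ++ v)) => [r1|]; case: (lquo i (p ++ B ++ v)) => [r2|] //= e.
apply: obeq_omap; first by move=> a b; apply: (beq_catl [:: x; i]).
by apply: H e _; move: hs; rewrite /= (lquo_size E1); lia.
Qed.

Lemma lquo_beq_below_all S : lquo_beq_below S.
Proof.
elim: S => [|S IHS] u v //= hs e.
elim: e hs => {u v}.
- by move=> w _ i; exact: obeq_refl.
- move=> u v e IH hs i; apply: obeq_sym; apply: IH; by rewrite (beq_size e).
- move=> u v w e1 IH1 e2 IH2 hs i; apply: obeq_trans (IH1 hs i) (IH2 _ i).
  by rewrite -(beq_size e1).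
- move=> u v a b hab hs; apply: (lquo_beq_below_prefix IHS) => // [i|q].
  + have hs' : size [:: a, b & v] <= S by move: hs; rewrite !size_cat /=; lia.
    by apply: obeq_of_le; apply: lquo_far_le IHS _ _; rewrite // farC.
  + exact: beq_comm.
- move=> u v a b hab hs; apply: (lquo_beq_below_prefix IHS) => // [i|q].
  + by apply: obeq_of_le; apply: lquo_braid_le; rewrite // adjacentC.
  + exact: beq_braid.
Qed.

Lemma lquo_beq i u v : beq u v -> obeq (lquo i u) (lquo i v).
Proof. by move=> e; exact: (@lquo_beq_below_all (size u).+1). Qed.

Lemma beq_cancel1 a u v : beq (a :: u) (a :: v) -> beq u v.
Proof. by move=> /(lquo_beq a); rewrite !lquo_eq. Qed.

Lemma beq_cancell p u v : beq (p ++ u) (p ++ v) -> beq u v.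
Proof. by elim: p => //= x p IH /beq_cancel1. Qed.

Lemma far_common_multiple i j u v : far i j -> beq (i :: u) (j :: v) ->
  exists w, beq u (j :: w) /\ beq v (i :: w).
Proof.
move=> h /(lquo_beq i); rewrite lquo_eq (lquo_far _ h).
case E: (lquo i v) => [w|] //= e; exists w; split => //; exact: lquo_sound.
Qed.

Lemma adjacent_common_multiple i j u v : adjacent i j -> beq (i :: u) (j :: v) ->
  exists w, beq u (j :: i :: w) /\ beq v (i :: j :: w).
Proof.
move=> h /(lquo_beq i); rewrite lquo_eq (lquo_adjacent _ h).
case E: (lquo i v) => [r|] //=; case E2: (lquo j r) => [w|] //= e.
exists w; split => //.
by apply: beq_trans (lquo_sound E) _; apply: beq_cons; exact: lquo_sound.
Qed.

Definition ldvd (x z : word) := exists w, beq (x ++ w) z.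

Lemma ldvd_refl x : ldvd x x.
Proof. by exists [::]; rewrite cats0; exact: beq_refl. Qed.

Lemma ldvd_nil x : ldvd [::] x.
Proof. by exists x; exact: beq_refl. Qed.

Lemma ldvd_cat x w : ldvd x (x ++ w).
Proof. by exists w; exact: beq_refl. Qed.

Lemma ldvd_beqr x z z' : ldvd x z -> beq z z' -> ldvd x z'.
Proof. by case=> w h e; exists w; exact: beq_trans e. Qed.

Lemma ldvd_beql x x' z : beq x x' -> ldvd x z -> ldvd x' z.
Proof. by move=> e [w h]; exists w; apply: beq_trans h; apply: beq_catr; exact: beq_sym. Qed.

Lemma ldvd_trans x y z : ldvd x y -> ldvd y z -> ldvd x z.
Proof.
case=> w1 h1 [w2 h2]; exists (w1 ++ w2); rewrite catA.
exact: beq_trans (beq_catr _ h1) h2.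
Qed.

Lemma ldvd_catl p x z : ldvd x z -> ldvd (p ++ x) (p ++ z).
Proof. by case=> w h; exists w; rewrite -catA; exact: beq_catl. Qed.

Lemma ldvd_cons a x z : ldvd x z -> ldvd (a :: x) (a :: z).
Proof. exact: (ldvd_catl [:: a]). Qed.

Lemma ldvd_cancell p x z : ldvd (p ++ x) (p ++ z) -> ldvd x z.
Proof. by case=> w h; exists w; apply: (beq_cancell (p := p)); rewrite catA. Qed.

Lemma ldvd_cancel1 a x z : ldvd (a :: x) (a :: z) -> ldvd x z.
Proof. exact: (ldvd_cancell (p := [:: a])). Qed.

Definition common_multiple1_below (L : nat) := forall P Q x i, size P <= L ->
  ldvd x P -> ldvd [:: i] P -> ldvd x Q -> ldvd [:: i] Q ->
  exists m, [/\ ldvd x m, ldvd [:: i] m, ldvd m P & ldvd m Q].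

Lemma common_multiple1_far L P Q x' i j : common_multiple1_below L ->
  far i j -> size P <= L.+1 ->
  ldvd (j :: x') P -> ldvd [:: i] P -> ldvd (j :: x') Q -> ldvd [:: i] Q ->
  exists m, [/\ ldvd (j :: x') m, ldvd [:: i] m, ldvd m P & ldvd m Q].
Proof.
move=> IH hf hs [w2 h2] [w1 h1] [w2' h2'] [w1' h1'].
have hji : far j i by rewrite farC.
have [w [ew1 ew2]] := far_common_multiple hf (beq_trans h1 (beq_sym h2)).
have [w' [ew1' ew2']] := far_common_multiple hf (beq_trans h1' (beq_sym h2')).
have hsw : size (i :: w) <= L.
  by move: hs; rewrite -(beq_size h1) /= (beq_size ew1) /=; lia.
have [m' [d1 [t ht] d3 d4]] := IH _ _ x' i hsw (ex_intro _ w2 ew2)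
  (ldvd_cat [:: i] w) (ex_intro _ w2' ew2') (ldvd_cat [:: i] w').
exists (j :: m'); split; first exact: ldvd_cons.
- by exists (j :: t); apply: beq_trans (beq_far0 _ hf) _; apply: beq_cons.
- apply: ldvd_beqr (ldvd_cons j d3) _; apply: beq_trans (beq_far0 _ hji) _.
  by apply: beq_trans _ h1; apply: beq_cons; exact: beq_sym.
- apply: ldvd_beqr (ldvd_cons j d4) _; apply: beq_trans (beq_far0 _ hji) _.
  by apply: beq_trans _ h1'; apply: beq_cons; exact: beq_sym.
Qed.

(* The multiple [j i m3] is built in two rounds: first a common multiple of
   [x'] and [i] below [i j w], then, after cancelling [i], one of its
   cofactor and [j]. *)
Lemma common_multiple1_adjacent L P Q x' i j : common_multiple1_below L ->
  adjacent i j -> size P <= L.+1 ->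
  ldvd (j :: x') P -> ldvd [:: i] P -> ldvd (j :: x') Q -> ldvd [:: i] Q ->
  exists m, [/\ ldvd (j :: x') m, ldvd [:: i] m, ldvd m P & ldvd m Q].
Proof.
move=> IH ha hs [w2 h2] [w1 h1] [w2' h2'] [w1' h1'].
have haji : adjacent j i by rewrite adjacentC.
have [w [ew1 ew2]] := adjacent_common_multiple ha (beq_trans h1 (beq_sym h2)).
have [w' [ew1' ew2']] := adjacent_common_multiple ha (beq_trans h1' (beq_sym h2')).
have hsw : size (i :: j :: w) <= L.
  by move: hs; rewrite -(beq_size h1) /= (beq_size ew1) /=; lia.
have [m' [d1 [m'' hm''] d3 d4]] := IH _ _ x' i hsw (ex_intro _ w2 ew2)
  (ldvd_cat [:: i] (j :: w)) (ex_intro _ w2' ew2') (ldvd_cat [:: i] (j :: w')).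
have d3' : ldvd m'' (j :: w).
  by apply: (ldvd_cancel1 (a := i)); apply: ldvd_beql d3; exact: beq_sym.
have d4' : ldvd m'' (j :: w').
  by apply: (ldvd_cancel1 (a := i)); apply: ldvd_beql d4; exact: beq_sym.
have hsw' : size (j :: w) <= L by move: hsw => /=; lia.
have [m3 [f1 [t ht] f3 f4]] :=
  IH _ _ m'' j hsw' d3' (ldvd_cat [:: j] w) d4' (ldvd_cat [:: j] w').
exists (j :: i :: m3); split.
- apply: ldvd_cons; apply: ldvd_trans d1 _.
  by apply: (ldvd_beql hm''); exact: ldvd_cons f1.
- exists (j :: i :: t); apply: beq_trans (beq_adjacent0 _ ha) _.
  exact: beq_catl [:: j; i] _ _ ht.
- apply: ldvd_beqr (ldvd_catl [:: j; i] f3) _ => /=.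
  apply: beq_trans (beq_adjacent0 _ haji) _.
  by apply: beq_trans _ h1; apply: beq_cons; exact: beq_sym.
- apply: ldvd_beqr (ldvd_catl [:: j; i] f4) _ => /=.
  apply: beq_trans (beq_adjacent0 _ haji) _.
  by apply: beq_trans _ h1'; apply: beq_cons; exact: beq_sym.
Qed.

Lemma common_multiple1 L : common_multiple1_below L.
Proof.
elim: L => [|L IH] P Q [|j x'] i hs.
- by move=> _ [w1 /beq_size h1]; move: hs; rewrite -h1.
- by move=> _ [w1 /beq_size h1]; move: hs; rewrite -h1.
- move=> _ hP _ hQ; exists [:: i]; split => //; [exact: ldvd_nil | exact: ldvd_refl].
case: (eqVneq i j) => [<-|nij].
  move=> hP _ hQ _; exists (i :: x'); split => //; first exact: ldvd_refl.
  exact: ldvd_cat [:: i] x'.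
case hf: (far i j); first exact: common_multiple1_far IH hf hs.
exact: common_multiple1_adjacent IH (adjacent_of_not_far nij hf) hs.
Qed.

Lemma ldvd_common_multiple z P Q x : ldvd x P -> ldvd z P -> ldvd x Q -> ldvd z Q ->
  exists m, [/\ ldvd x m, ldvd z m, ldvd m P & ldvd m Q].
Proof.
elim: z P Q x => [|i z IH] P Q x hxP hzP hxQ hzQ.
  by exists x; split => //; [exact: ldvd_refl | exact: ldvd_nil].
have hiP : ldvd [:: i] P by apply: ldvd_trans hzP; exact: ldvd_cat [:: i] z.
have hiQ : ldvd [:: i] Q by apply: ldvd_trans hzQ; exact: ldvd_cat [:: i] z.
have [m1 [a1 [m1' hm1] [r hr] [r' hr']]] := common_multiple1 (leqnn _) hxP hiP hxQ hiQ.
have eP : beq (i :: (m1' ++ r)) P by apply: beq_trans (beq_catr r hm1) hr.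
have eQ : beq (i :: (m1' ++ r')) Q by apply: beq_trans (beq_catr r' hm1) hr'.
have hz1 : ldvd z (m1' ++ r).
  by apply: (ldvd_cancel1 (a := i)); apply: ldvd_beqr hzP _; exact: beq_sym.
have hz2 : ldvd z (m1' ++ r').
  by apply: (ldvd_cancel1 (a := i)); apply: ldvd_beqr hzQ _; exact: beq_sym.
have [m' [b1 b2 b3 b4]] := IH _ _ m1' (ldvd_cat _ _) hz1 (ldvd_cat _ _) hz2.
exists (i :: m'); split.
- by apply: ldvd_trans a1 _; apply: (ldvd_beql hm1); exact: ldvd_cons b1.
- exact: ldvd_cons.
- exact: ldvd_beqr (ldvd_cons i b3) eP.
- exact: ldvd_beqr (ldvd_cons i b4) eQ.
Qed.

Definition swap (i k : nat) := if k == i then i.+1 else if k == i.+1 then i else k.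

Lemma swap_spec i k : (k = i /\ swap i k = i.+1) \/ (k = i.+1 /\ swap i k = i) \/
  (k <> i /\ k <> i.+1 /\ swap i k = k).
Proof. by rewrite /swap; case: eqP => h1; [left|case: eqP => h2; right; [left|right]]. Qed.

Ltac swap_cases :=
  repeat match goal with H : context [swap _ _] |- _ => revert H end;
  repeat match goal with |- context [swap ?i ?k] =>
    have := swap_spec i k; move: (swap i k) => ? end;
  intros.

Lemma swapK i : involutive (swap i).
Proof. by move=> k; swap_cases; lia. Qed.

Lemma swap_inj i : injective (swap i).
Proof. exact: inv_inj (swapK i). Qed.

Lemma swap_le i n k : 0 < i < n -> k <= n -> swap i k <= n.
Proof. by move=> h hk; swap_cases; lia. Qed.

Lemma swap_l i : swap i i = i.+1.
Proof. by rewrite /swap eqxx. Qed.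

Lemma swap_r i : swap i i.+1 = i.
Proof. by swap_cases; lia. Qed.

Lemma swap_id i k : k <> i -> k <> i.+1 -> swap i k = k.
Proof. by move=> h1 h2; swap_cases; lia. Qed.

(* The letter [i] acts as the transposition [(i i.+1)], the rightmost letter
   first, so the right descents of a simple braid [w] are the [i] with
   [wperm w i.+1 < wperm w i]. *)
Definition wperm (w : word) : nat -> nat := foldr (fun i f k => swap i (f k)) id w.

Lemma wperm_cat u v k : wperm (u ++ v) k = wperm u (wperm v k).
Proof. by elim: u => //= i u ->. Qed.

Lemma wperm_rcons w i k : wperm (rcons w i) k = wperm w (swap i k).
Proof. by rewrite -cats1 wperm_cat. Qed.

Lemma wperm_inj w : injective (wperm w).
Proof. by elim: w => //= i w IH x y /swap_inj; exact: IH. Qed.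

Lemma beq_wperm u v : beq u v -> wperm u =1 wperm v.
Proof.
elim=> {u v} [//|u v _ IH k|u v w _ IH1 _ IH2 k|u v i j h k|u v i j h k].
- by rewrite IH.
- by rewrite IH1 IH2.
- by rewrite !wperm_cat /=; congr (wperm u _); move: h; rewrite /far; swap_cases; lia.
- by rewrite !wperm_cat /=; congr (wperm u _); move: h; rewrite /adjacent; swap_cases; lia.
Qed.

Lemma wf_rcons n w i : wf n (rcons w i) = wf n w && (0 < i < n).
Proof. by rewrite /wf all_rcons andbC. Qed.

Lemma wperm_out n w k : wf n w -> (k == 0) || (n < k) -> wperm w k = k.
Proof.
by elim: w => //= i w IH /andP[hi hw] hk; rewrite IH //; move: hi hk; swap_cases; lia.
Qed.

Lemma wperm_in n w k : wf n w -> 0 < k <= n -> 0 < wperm w k <= n.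
Proof.
by elim: w => //= i w IH /andP[hi hw] hk; have := IH hw hk; move: hi; swap_cases; lia.
Qed.

Definition inversions n (f : nat -> nat) : nat :=
  \sum_(p : 'I_n.+1 * 'I_n.+1 | (0 < p.1) && (p.1 < p.2)) (f p.2 < f p.1).

Lemma eq_inversions n f g : {in [pred k | k <= n], f =1 g} -> inversions n f = inversions n g.
Proof. by move=> h; apply: eq_bigr => -[x y] _ /=; rewrite !h // inE -ltnS. Qed.

Lemma inversions_id n : inversions n id = 0.
Proof. by apply: big1 => -[x y] /= /andP[_ h]; rewrite ltnNge ltnW. Qed.

Lemma inversions_swap n f i : 0 < i < n -> f i != f i.+1 ->
  inversions n (f \o swap i) + (f i.+1 < f i) = inversions n f + (f i < f i.+1).
Proof.
move=> /andP[hi0 hin] hne.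
pose swo (x : 'I_n.+1) : 'I_n.+1 := inord (swap i x).
have swoE x : val (swo x) = swap i x.
  by rewrite /swo /= inordK // ltnS; apply: swap_le; [rewrite hi0 hin | rewrite -ltnS].
have swoK : involutive swo by move=> x; apply: val_inj; rewrite !swoE swapK.
pose h (p : 'I_n.+1 * 'I_n.+1) := (swo p.1, swo p.2).
have hinj : injective h.
  by move=> [a b] [c d] /= [/(inv_inj swoK) -> /(inv_inj swoK) ->].
rewrite /inversions (reindex_inj hinj) /=.
under eq_bigr => p _ do rewrite !swoE !swapK.
pose e1 : 'I_n.+1 * 'I_n.+1 := (inord i, inord i.+1).
pose e2 : 'I_n.+1 * 'I_n.+1 := (inord i.+1, inord i).
have vi : val (inord i : 'I_n.+1) = i by rewrite /= inordK // ltnW.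
have vi1 : val (inord i.+1 : 'I_n.+1) = i.+1 by rewrite /= inordK.
rewrite (bigD1 e2) /=; last by rewrite !swoE vi vi1 swap_l swap_r; lia.
rewrite [in RHS](bigD1 e1) /=; last by rewrite vi vi1 hi0 ltnSn.
rewrite vi vi1.
have -> : \sum_(p : 'I_n.+1 * 'I_n.+1 | (0 < swo p.1 < swo p.2) && (p != e2)) (f p.2 < f p.1)
  = \sum_(p : 'I_n.+1 * 'I_n.+1 | (0 < p.1 < p.2) && (p != e1)) (f p.2 < f p.1).
  apply: eq_bigl => -[x y] /=; rewrite !swoE.
  rewrite /e1 /e2 !xpair_eqE -!val_eqE /= vi vi1.
  by swap_cases; apply/idP/idP; lia.
by rewrite [LHS]addnC [RHS]addnC !addnA; congr (_ + _); exact: addnC.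
Qed.

Definition reduced n w := size w = inversions n (wperm w).

Lemma reduced0 n : reduced n [::].
Proof. by rewrite /reduced inversions_id. Qed.

Lemma inversions_rcons n w i : wf n (rcons w i) ->
  inversions n (wperm (rcons w i)) + (wperm w i.+1 < wperm w i) =
  inversions n (wperm w) + (wperm w i < wperm w i.+1).
Proof.
rewrite wf_rcons => /andP[hw hi].
rewrite (@eq_inversions n _ (wperm w \o swap i)); last by move=> k _; rewrite wperm_rcons.
by apply: inversions_swap => //; apply/eqP => /wperm_inj; lia.
Qed.

Lemma inversions_le_size n w : wf n w -> inversions n (wperm w) <= size w.
Proof.
elim/last_ind: w => [|w i IH]; first by rewrite /= inversions_id.
move=> h; have := inversions_rcons h; move: h; rewrite wf_rcons size_rcons => /andP[hw _].
by have := IH hw; lia.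
Qed.

Lemma reduced_rcons n w k : wf n (rcons w k) ->
  reduced n (rcons w k) <-> reduced n w /\ wperm w k < wperm w k.+1.
Proof.
move=> h; have := inversions_rcons h; move: h; rewrite wf_rcons => /andP[hw hk].
have := inversions_le_size hw; rewrite /reduced size_rcons => h1 h2.
have hne : wperm w k != wperm w k.+1 by apply/eqP => /wperm_inj; lia.
by split=> [e|[e hc]]; [split|]; lia.
Qed.

Lemma reduced_prefix n u v : wf n (u ++ v) -> reduced n (u ++ v) -> reduced n u.
Proof.
elim/last_ind: v => [|v k IH]; first by rewrite cats0.
rewrite -rcons_cat => hw hr; have [h _] := (reduced_rcons hw).1 hr.
by apply: IH => //; move: hw; rewrite wf_rcons => /andP[].
Qed.

Lemma reduced_beq n u v : beq u v -> reduced n u -> reduced n v.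
Proof.
move=> e; rewrite /reduced (beq_size e) => ->.
by apply: eq_inversions => k _; exact: beq_wperm.
Qed.

Lemma beq_rcons_reduced n w w' j : wf n w -> reduced n w -> beq w (rcons w' j) ->
  wf n w' /\ reduced n w'.
Proof.
move=> hw hr e; have hw' : wf n (rcons w' j) by rewrite -(beq_wf n e).
split; first by move: hw'; rewrite wf_rcons => /andP[].
rewrite -cats1 in e hw'; exact: reduced_prefix hw' (reduced_beq e hr).
Qed.

Definition exchange_below n m := forall w j, size w <= m -> wf n w -> reduced n w ->
  0 < j < n -> wperm w j.+1 < wperm w j -> exists w', beq w (rcons w' j).

Lemma adjacent_descents (f : nat -> nat) i j : adjacent i j ->
  f i.+1 < f i -> f j.+1 < f j ->
  f (swap i j.+1) < f (swap i j) /\ f (swap i (swap j i.+1)) < f (swap i (swap j i)).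
Proof.
rewrite /adjacent => /orP[] /eqP <- h1 h2.
- have e1 : swap i i.+2 = i.+2 by apply: swap_id; lia.
  have e2 : swap i.+1 i = i by apply: swap_id; lia.
  by rewrite swap_l swap_r e1 e2 swap_l; lia.
- have e1 : swap j.+1 j = j by apply: swap_id; lia.
  have e2 : swap j j.+2 = j.+2 by apply: swap_id; lia.
  by rewrite swap_l swap_r e1 e2 swap_r; lia.
Qed.

(* With [w = w0 i] and descents at [i] and [j], extract [j] and then [i]
   from [w0], and conclude by [w2 j i j = w2 i j i]. *)
Lemma exchange_adjacent n m w0 i j : exchange_below n m -> adjacent i j ->
  size w0 <= m -> wf n (rcons w0 i) -> reduced n (rcons w0 i) -> 0 < j < n ->
  wperm (rcons w0 i) j.+1 < wperm (rcons w0 i) j ->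
  exists w', beq (rcons w0 i) (rcons w' j).
Proof.
move=> IH ha hs hw hr hj hd.
have [hr0 hasc] := (reduced_rcons hw).1 hr.
move: (hw); rewrite wf_rcons => /andP[hw0 hi].
have hdi : wperm (rcons w0 i) i.+1 < wperm (rcons w0 i) i.
  by rewrite !wperm_rcons swap_l swap_r.
have [hd0 hd1] := adjacent_descents ha hdi hd.
rewrite !wperm_rcons !swapK in hd0 hd1.
have [w1 e1] := IH w0 j hs hw0 hr0 hj hd0.
have [hw1 hr1] := beq_rcons_reduced hw0 hr0 e1.
have hs1 : size w1 <= m by move: hs; rewrite (beq_size e1) size_rcons; lia.
have [|w2 e2] := IH w1 i hs1 hw1 hr1 hi.
  by move: hd1; rewrite !(beq_wperm e1) !wperm_rcons !swapK.
exists (w2 ++ [:: j; i]); rewrite -!cats1 in e1 e2 *.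
apply: beq_trans (beq_catr [:: i] (beq_trans e1 (beq_catr [:: j] e2))) _.
by rewrite -!catA /=; apply: beq_adjacent.
Qed.

Lemma exchange_below_all n m : exchange_below n m.
Proof.
elim: m => [|m IH] w j; first by case: w => //= _ _ _ _; lia.
case/lastP: w => [|w0 i]; first by move=> _ _ _ _ /=; lia.
move=> hs hw hr hj hd.
have hs0 : size w0 <= m by move: hs; rewrite size_rcons.
case: (eqVneq i j) => [<-|nij]; first by exists w0; exact: beq_refl.
case hf: (far i j); last first.
  exact: exchange_adjacent IH (adjacent_of_not_far nij hf) hs0 hw hr hj hd.
have [hr0 _] := (reduced_rcons hw).1 hr.
move: (hw); rewrite wf_rcons => /andP[hw0 _].
have [|w1 e1] := IH w0 j hs0 hw0 hr0 hj.
  by move: hd hf; rewrite !wperm_rcons /far => hd hf; rewrite !swap_id in hd; lia.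
exists (rcons w1 i); rewrite -!cats1 in e1 *.
apply: beq_trans (beq_catr [:: i] e1) _.
by rewrite -!catA /=; apply: beq_far; rewrite farC.
Qed.

Lemma exchange n w j : wf n w -> reduced n w -> 0 < j < n ->
  wperm w j.+1 < wperm w j -> exists w', beq w (rcons w' j).
Proof. exact: (exchange_below_all (leqnn _)). Qed.

Lemma reduced_nil n v : reduced n v -> wperm v =1 id -> v = [::].
Proof.
move=> + hp; rewrite /reduced (@eq_inversions n _ id) ?inversions_id //.
by case: v {hp}.
Qed.

Theorem Matsumoto n u v : wf n u -> wf n v -> reduced n u -> reduced n v ->
  wperm u =1 wperm v -> beq u v.
Proof.
elim/last_ind: u v => [|u0 i IH] v hu hv hru hrv hp.
  by rewrite (reduced_nil hrv (fun k => esym (hp k))); exact: beq_refl.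
have [hr0 hasc] := (reduced_rcons hu).1 hru.
move: (hu); rewrite wf_rcons => /andP[hu0 hi].
have [|v1 e1] := exchange hv hrv hi; first by rewrite -!hp !wperm_rcons swap_l swap_r.
have [hw1 hr1] := beq_rcons_reduced hv hrv e1.
have e0 : beq u0 v1.
  apply: IH => // k.
  by rewrite -(swapK i k) -wperm_rcons hp (beq_wperm e1) wperm_rcons.
by apply: beq_trans (beq_sym e1); rewrite -!cats1; exact: beq_catr.
Qed.

Ltac case_ifs := repeat (case: ifP => ?).

Lemma wperm_iota i d k : wperm (iota i d) k =
  if (i <= k) && (k < i + d) then k.+1 else if k == i + d then i else k.
Proof.
elim: d k => [|d IH] k.
  by rewrite /= addn0; case: ifP => [/andP[]|_]; [lia|case: eqP => [->|]].
by rewrite -addn1 iotaD /= cats1 wperm_rcons IH; swap_cases; case_ifs; lia.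
Qed.

Lemma wperm_sig i m k : 0 < i <= m -> wperm (sig i m) k =
  if (i <= k) && (k < m) then k.+1 else if k == m then i else k.
Proof. by move=> h; rewrite /sig wperm_iota subnKC //; lia. Qed.

Lemma wperm_Delta n k : wperm (Delta n) k = if 0 < k <= n then n.+1 - k else k.
Proof.
elim: n k => [|n IH] k /=; first by case: ifP => //; lia.
by rewrite wperm_cat IH; case: ifP => h; rewrite wperm_sig; try lia; case_ifs; lia.
Qed.

Lemma wf_cat n u v : wf n (u ++ v) = wf n u && wf n v.
Proof. exact: all_cat. Qed.

Lemma wf_le n m w : n <= m -> wf n w -> wf m w.
Proof. by move=> h; apply: sub_all => i /andP[h1 h2]; rewrite h1 /=; lia. Qed.

Lemma wf_sig i m : 0 < i -> wf m (sig i m).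
Proof. by move=> h; apply/allP => x; rewrite /sig mem_iota => /andP[h1 h2]; lia. Qed.

Lemma wf_Delta n : wf n (Delta n).
Proof. by elim: n => //= n IH; rewrite wf_cat wf_sig //=; exact: wf_le IH. Qed.

Lemma reduced_iota n i d : 0 < i -> i + d <= n -> reduced n (iota i d).
Proof.
move=> hi; elim: d => [|d IH] hd; first exact: reduced0.
have hw : wf n (rcons (iota i d) (i + d)).
  rewrite -cats1 -[[:: i + d]]/(iota (i + d) 1) -iotaD.
  by apply/allP => x; rewrite mem_iota; lia.
rewrite -addn1 iotaD /= cats1; apply/(reduced_rcons hw); split; first by apply: IH; lia.
by rewrite !wperm_iota; case_ifs; lia.
Qed.

Lemma reduced_sig_cat m s i : wf m s -> reduced m s -> 0 < i <= m.+1 ->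
  wf m.+1 (sig i m.+1 ++ s) /\ reduced m.+1 (sig i m.+1 ++ s).
Proof.
move=> hw hr hi.
have hw' : wf m.+1 (sig i m.+1 ++ s).
  by rewrite wf_cat wf_sig ?(wf_le (leqnSn m) hw) //; case/andP: hi.
split => //.
elim/last_ind: s hw hr hw' => [|s k IH] hw hr hw'.
  by rewrite cats0 /sig; apply: reduced_iota; lia.
rewrite -rcons_cat; apply/reduced_rcons; first by rewrite rcons_cat.
move: (hw); rewrite wf_rcons => /andP[hws hk].
have [hrs hasc] := (reduced_rcons hw).1 hr.
split; first by apply: IH => //; move: hw'; rewrite -rcons_cat wf_rcons => /andP[].
have := wperm_in (k := k) hws ltac:(lia); have := wperm_in (k := k.+1) hws ltac:(lia).
rewrite !wperm_cat !wperm_sig; try lia.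
by move: hasc; move: (wperm s k) (wperm s k.+1) => a b; case_ifs; lia.
Qed.

Lemma reduced_Delta n : reduced n (Delta n).
Proof.
elim: n => [|n IH] /=; first exact: reduced0.
by have [] := reduced_sig_cat (i := 1) (wf_Delta n) IH ltac:(lia).
Qed.

Lemma nth_allpairs (A B C : Type) (f : A -> B -> C) (a0 : A) (b0 : B) (c0 : C)
    (s : seq A) (t : seq B) q k : q < size s -> k < size t ->
  nth c0 [seq f a b | a <- s, b <- t] (q * size t + k) = f (nth a0 s q) (nth b0 t k).
Proof.
elim: s q => //= a s IH [|q] hq hk /=; first by rewrite nth_cat size_map hk (nth_map b0).
by rewrite nth_cat size_map mulSn -addnA ltnNge leq_addr /= addKn IH.
Qed.

Lemma Slist_S m : 0 < m ->
  Slist m.+1 = [seq sig i m.+1 ++ s | i <- rev (iota 1 m.+1), s <- Slist m].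
Proof. by case: m. Qed.

Lemma size_Slist m : 0 < m -> size (Slist m) = m`!.
Proof.
elim: m => // m IH _; case: (posnP m) => [->//|hm].
by rewrite Slist_S // size_allpairs size_rev size_iota IH // factS.
Qed.

Lemma tau_block m q k : 0 < m -> q < m.+1 -> k < m`! ->
  tau m.+1 (q * m`! + k) = sig (m.+1 - q) m.+1 ++ tau m k.
Proof.
move=> hm hq hk; rewrite /tau Slist_S // -(size_Slist hm).
rewrite (nth_allpairs _ 0 [::]) ?size_rev ?size_iota ?size_Slist //.
by rewrite nth_rev size_iota // nth_iota; [congr (sig _ _ ++ _); lia | lia].
Qed.

Lemma tau_prefix m k : 0 < m -> k < m`! -> tau m.+1 k = tau m k.
Proof.
move=> hm hk; have := tau_block (q := 0) hm (ltn0Sn m) hk.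
by rewrite mul0n add0n subn0 /sig subnn.
Qed.

Lemma tau_first m : 0 < m -> tau m 0 = [::].
Proof.
elim: m => // m IH _; case: (posnP m) => [->//|hm].
by rewrite tau_prefix ?IH ?fact_gt0.
Qed.

Lemma tau_last m : 0 < m -> tau m (m`!.-1) = Delta m.
Proof.
elim: m => // m IH _; case: (posnP m) => [->//|hm].
have hf := fact_gt0 m.
have -> : (m.+1)`!.-1 = m * m`! + m`!.-1 by rewrite factS; lia.
by rewrite tau_block ?IH ?subSn ?subnn //; lia.
Qed.

Lemma mem_Slist m x : 0 < m -> x \in Slist m -> wf m x /\ reduced m x.
Proof.
elim: m x => // m IH x _; case: (posnP m) => [->|hm].
  by rewrite inE => /eqP ->; split => //; exact: reduced0.
rewrite Slist_S // => /allpairsP[[i s] /= [hi hs ->]].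
have [hw hr] := IH s hm hs.
by apply: reduced_sig_cat => //; move: hi; rewrite mem_rev inE mem_iota; lia.
Qed.

Lemma tau_simple m k : 0 < m -> k < m`! -> wf m (tau m k) /\ reduced m (tau m k).
Proof.
by move=> hm hk; apply: mem_Slist => //; rewrite /tau mem_nth // size_Slist.
Qed.

Lemma block_index m k : 0 < m -> k < (m.+1)`! ->
  exists q r, [/\ q < m.+1, r < m`! & k = q * m`! + r].
Proof.
move=> hm hk; exists (k %/ m`!), (k %% m`!); split; last exact: divn_eq.
- by rewrite ltn_divLR ?fact_gt0 // -factS.
- by rewrite ltn_pmod ?fact_gt0.
Qed.

Lemma size_sig i m : size (sig i m) = m - i.
Proof. by rewrite /sig size_iota. Qed.

Lemma size_tau_gt0 m l : 0 < m -> 0 < l < m`! -> 0 < size (tau m l).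
Proof.
elim: m l => // m IH l _; case: (posnP m) => [->|hm]; first by case: l => // -[].
move=> /andP[hl hk]; have [q [r [hq hr e]]] := block_index hm hk.
rewrite e tau_block // size_cat size_sig.
case: (posnP q) => [hq0|hq0]; last by lia.
by rewrite hq0 /= in e *; rewrite subn0 subnn /= IH //; lia.
Qed.

Lemma inversions_max n f : inversions n f <= inversions n (wperm (Delta n)).
Proof.
apply: leq_sum => -[x y] /= /andP[h1 h2]; rewrite !wperm_Delta.
have hy := ltn_ord y; rewrite ltnS in hy.
have hx : x <= n by apply: leq_trans (ltnW h2) hy.
rewrite h1 hx /= (leq_trans h1 (ltnW h2)) hy /=.
by case: (f y < f x) => //=; lia.
Qed.

Lemma reduced_size_le n z : reduced n z -> size z <= size (Delta n).
Proof. by rewrite /reduced (reduced_Delta n) => ->; exact: inversions_max. Qed.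

Lemma decreasing_rev n f : {in [pred k | 0 < k <= n], forall k, 0 < f k <= n} ->
  (forall k, 0 < k < n -> f k.+1 < f k) ->
  {in [pred k | 0 < k <= n], forall k, f k = n.+1 - k}.
Proof.
move=> hr hd.
have H d k : 0 < k -> k + d <= n -> f (k + d) + d <= f k.
  elim: d => [|d IH] hk hkd; first by rewrite !addn0.
  have := IH hk ltac:(lia); have := hd (k + d) ltac:(lia).
  by rewrite (addnS k d); move: (f (k + d).+1) (f (k + d)) (f k) => a b c; lia.
move=> k /andP[hk0 hkn].
have := H (n - k) k hk0 ltac:(lia); have := H k.-1 1 (ltn0Sn 0) ltac:(lia).
rewrite subnKC // add1n (ltn_predK hk0).
have := hr 1 ltac:(rewrite inE; lia); have := hr n ltac:(rewrite inE; lia).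
by move: (f 1) (f n) (f k) => a b c; lia.
Qed.

Lemma descents_beq_Delta n z : wf n z -> reduced n z ->
  (forall k, 0 < k < n -> wperm z k.+1 < wperm z k) -> beq z (Delta n).
Proof.
move=> hw hr hdesc; have hp : wperm z =1 wperm (Delta n).
  move=> k; rewrite wperm_Delta; case: ifP => hk; last by apply: (wperm_out hw); lia.
  by apply: decreasing_rev => // x hx; exact: wperm_in hw hx.
exact: Matsumoto hw (wf_Delta n) hr (reduced_Delta n) hp.
Qed.

Lemma ascent_or_Delta n z : wf n z -> reduced n z ->
  beq z (Delta n) \/ exists2 k, 0 < k < n & wperm z k < wperm z k.+1.
Proof.
move=> hw hr.
case: (boolP [exists k : 'I_n, (0 < k) && (wperm z k < wperm z k.+1)]).
  by case/existsP => k /andP[hk0 hk]; right; exists (nat_of_ord k); rewrite ?hk0 ?ltn_ord.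
move=> /existsPn hne; left; apply: descents_beq_Delta => // k hk.
case: (ltngtP (wperm z k) (wperm z k.+1)) => // [h|/wperm_inj]; last by lia.
by have := hne (Ordinal (proj2 (andP hk))); rewrite /= h andbT; case/andP: hk => ->.
Qed.

(* Appending ascents keeps [z] reduced, and lengths of reduced words are
   bounded by [size (Delta n)]. *)
Lemma reduced_ldvd_Delta n z : wf n z -> reduced n z -> ldvd z (Delta n).
Proof.
move: {2}(size (Delta n) - size z) (leqnn (size (Delta n) - size z)) => d.
elim: d z => [|d IH] z hd hw hr; have [e|[k hk hasc]] := ascent_or_Delta hw hr;
  try by exists [::]; rewrite cats0.
all: have hw' : wf n (rcons z k) by rewrite wf_rcons hw hk.
all: have hr' := (reduced_rcons hw').2 (conj hr hasc).
all: have := reduced_size_le hr'; rewrite size_rcons => hle.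
  by lia.
apply: ldvd_trans (IH _ _ hw' hr'); last by rewrite size_rcons; lia.
by rewrite -cats1; exact: ldvd_cat.
Qed.

Lemma ldiv_ldvd n x z : ldiv n x z -> ldvd x z.
Proof. by case=> w [_ e]; exists w. Qed.

Lemma ldvd_wf n x z : wf n z -> ldvd x z -> wf n x.
Proof. by move=> hz [w e]; move: hz; rewrite -(beq_wf n e) wf_cat => /andP[]. Qed.

Lemma ldvd_ldiv n x z : wf n z -> ldvd x z -> ldiv n x z.
Proof.
move=> hz [w e]; exists w; split => //.
by move: hz; rewrite -(beq_wf n e) wf_cat => /andP[].
Qed.

Lemma ldvd_reduced n x z : wf n z -> reduced n z -> ldvd x z -> reduced n x.
Proof.
move=> hz hr [w e]; apply: (reduced_prefix (v := w)); first by rewrite (beq_wf n e).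
exact: reduced_beq (beq_sym e) hr.
Qed.

Lemma ldiv_Delta n x : wf n x -> reduced n x -> ldiv n x (Delta n).
Proof. by move=> hw hr; apply: ldvd_ldiv (wf_Delta n) (reduced_ldvd_Delta hw hr). Qed.

Lemma DR_wperm n w i : wf n w -> reduced n w ->
  DR n w i <-> 0 < i < n /\ wperm w i.+1 < wperm w i.
Proof.
move=> hw hr; split=> [[hi [c [hc e]]]|[hi hd]]; split => //.
- have hw' : wf n (rcons c i) by rewrite -cats1 (beq_wf n e).
  have hr' : reduced n (rcons c i).
    by apply: reduced_beq hr; rewrite -cats1; exact: beq_sym.
  have [_ h] := (reduced_rcons hw').1 hr'.
  by rewrite -!(beq_wperm e) cats1 !wperm_rcons swap_l swap_r.
- have [w' e] := exchange hw hr hi hd.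
  exists w'; split; last by rewrite cats1; exact: beq_sym.
  by move: hw; rewrite (beq_wf n e) wf_rcons => /andP[].
Qed.

Lemma DL_ldvd n y i : DL n y i -> 0 < i < n /\ ldvd [:: i] y.
Proof. by case=> h [w [_ e]]; split => //; exists w. Qed.

Lemma normal_DL_DR n x y i : wf n x -> wf n y -> reduced n x ->
  normal n x y -> DL n y i -> DR n x i.
Proof.
move=> hx hy hr [_ _ H] /DL_ldvd[hi [y' ey]]; apply/(DR_wperm _ hx hr); split => //.
case: (ltngtP (wperm x i) (wperm x i.+1)) => // [hc|/wperm_inj]; last by lia.
have hw' : wf n (rcons x i) by rewrite wf_rcons hx hi.
have hr' := (reduced_rcons hw').2 (conj hr hc).
have [|w [_ /beq_size]] := H (rcons x i) hw' (ldiv_Delta hw' hr').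
  apply: ldvd_ldiv; first by rewrite wf_cat hx hy.
  by exists y'; rewrite -cats1 -catA; exact: beq_catl.
by rewrite size_cat size_rcons; lia.
Qed.

(* A common multiple [x ++ c] of [x] and [z] dividing both [Delta n] and
   [x ++ y] is reduced; if [c] started with a letter [k], then [k] would be an
   ascent of [x] lying in [DL n y], hence in [DR n x]. *)
Lemma DL_DR_normal n x y : wf n x -> wf n y -> reduced n x ->
  (forall i, DL n y i -> DR n x i) -> normal n x y.
Proof.
move=> hx hy hr H; split; first exact: ldiv_Delta.
  by apply: ldvd_ldiv (ldvd_cat x y); rewrite wf_cat hx hy.
move=> z hz /ldiv_ldvd hzD /ldiv_ldvd hzP.
have [m [[[|k c] ec] hzm [r er] hmD]] :=
  ldvd_common_multiple (ldvd_cat x y) hzP (reduced_ldvd_Delta hx hr) hzD.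
  apply: (ldvd_ldiv hx); apply: ldvd_trans hzm _.
  by exists [::]; rewrite !cats0 in ec *; exact: beq_sym ec.
have hmr := ldvd_reduced (wf_Delta n) (reduced_Delta n) hmD.
have hw1 : wf n (rcons x k ++ c).
  by rewrite cat_rcons (beq_wf n ec); exact: ldvd_wf (wf_Delta n) hmD.
have hw2 : wf n (rcons x k) by move: hw1; rewrite wf_cat => /andP[].
have hr1 : reduced n (rcons x k ++ c).
  by rewrite cat_rcons; exact: reduced_beq (beq_sym ec) hmr.
have [_ hasc] := (reduced_rcons hw2).1 (reduced_prefix hw1 hr1).
have hk : 0 < k < n by move: hw2; rewrite wf_rcons => /andP[].
have e : beq (x ++ (k :: c ++ r)) (x ++ y).
  by apply: beq_trans _ er; rewrite -cat_cons catA; exact: beq_catr.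
have hDL : DL n y k.
  by split => //; apply: (ldvd_ldiv hy); exists (c ++ r); exact: beq_cancell e.
have [_ hd] := (DR_wperm _ hx hr).1 (H k hDL).
by lia.
Qed.

Lemma normalP n x y : wf n x -> wf n y -> reduced n x ->
  normal n x y <-> (forall i, DL n y i -> DR n x i).
Proof.
move=> hx hy hr; split; first by move=> hN i; exact: normal_DL_DR.
exact: DL_DR_normal.
Qed.

Lemma size_tau_lt m k : 0 < m -> k < m`!.-1 -> size (tau m k) < size (Delta m).
Proof.
elim: m k => // m IH k _; case: (posnP m) => [->|hm] //.
have hf := fact_gt0 m; move=> hk.
have [q [r [hq hr ek]]] := block_index hm (leq_trans hk (leq_pred _)); subst k.
rewrite tau_block // size_cat size_sig /= size_cat size_sig.
have [_ /reduced_size_le hle] := tau_simple hm hr.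
case: (ltnP q m) => hqm; first by lia.
have hqm' : q = m by lia.
have /IH : r < m`!.-1 by move: hk; rewrite factS hqm'; nia.
by move=> /(_ hm); lia.
Qed.

Lemma eq_Mentry m k l m' k' l' :
    (normal m (tau m k) (tau m l) <-> normal m' (tau m' k') (tau m' l')) ->
  Mentry m k l = Mentry m' k' l'.
Proof.
rewrite /Mentry => h.
by case: excluded_middle_informative => a; case: excluded_middle_informative => b //;
  exfalso; tauto.
Qed.

Lemma Mentry1 m k l : normal m (tau m k) (tau m l) -> Mentry m k l = 1.
Proof. by rewrite /Mentry; case: excluded_middle_informative. Qed.

Lemma Mentry0 m k l : ~ normal m (tau m k) (tau m l) -> Mentry m k l = 0.
Proof. by rewrite /Mentry; case: excluded_middle_informative. Qed.

Lemma normal_tauP n k l : 0 < n -> k < n`! -> l < n`! ->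
  normal n (tau n k) (tau n l) <-> (forall i, DL n (tau n l) i -> DR n (tau n k) i).
Proof.
move=> hn hk hl; have [hx hr] := tau_simple hn hk; have [hy _] := tau_simple hn hl.
exact: normalP.
Qed.

Lemma DL_nil n i : ~ DL n [::] i.
Proof. by case=> _ [w [_ /beq_size]]. Qed.

Lemma DR_nil n i : ~ DR n [::] i.
Proof. by case=> _ [w [_ /beq_size]]; rewrite size_cat addn1. Qed.

Lemma DL_Delta n i : 0 < i < n -> DL n (Delta n) i.
Proof.
move=> hi; split => //; apply: ldvd_ldiv (wf_Delta n) (reduced_ldvd_Delta _ _).
- by rewrite /wf /= hi.
- by apply: (@reduced_iota n i 1); lia.
Qed.

Lemma DR_Delta n i : 0 < i < n -> DR n (Delta n) i.
Proof.
move=> hi; apply/(DR_wperm _ (wf_Delta n) (reduced_Delta n)); split => //.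
by rewrite !wperm_Delta; case_ifs; lia.
Qed.

Lemma normal_nil_r n x : wf n x -> reduced n x -> normal n x [::].
Proof. by move=> hx hr; apply/normalP => // i /DL_nil. Qed.

Lemma normal_Delta_l n y : wf n y -> normal n (Delta n) y.
Proof.
move=> hy; apply/(normalP (wf_Delta n) hy (reduced_Delta n)) => i /DL_ldvd[hi _].
exact: DR_Delta.
Qed.

Lemma normal_nil_l n y : wf n y -> normal n [::] y -> y = [::].
Proof.
case: y => // i y' hy /(normal_DL_DR (isT : wf n [::]) hy (reduced0 n)) H.
case: (@DR_nil n i); apply: H; move: hy; rewrite /wf /= => /andP[hi hy'].
by split => //; exists y'; split => //; exact: beq_refl.
Qed.

Lemma normal_Delta_r n x : wf n x -> reduced n x -> normal n x (Delta n) ->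
  beq x (Delta n).
Proof.
move=> hx hr /(normalP hx (wf_Delta n) hr) H.
apply: descents_beq_Delta => // i hi.
by have [] := (DR_wperm _ hx hr).1 (H i (DL_Delta hi)).
Qed.

Lemma DL_widen m y i : DL m y i -> DL m.+1 y i.
Proof. by case=> hi [w [hw e]]; split; [lia | exists w; split => //; exact: wf_le hw]. Qed.

Lemma DL_narrow m y i : wf m y -> DL m.+1 y i -> DL m y i.
Proof.
move=> hy /DL_ldvd[hi hdv].
have := ldvd_wf hy hdv; rewrite /wf /= andbT => hi'.
by split => //; exact: ldvd_ldiv.
Qed.

(* [sig j m.+1] maps [{1, ..., m}] increasingly into [{1, ..., m.+1}], so
   multiplying on the left by it does not change descents below [m]. *)
Lemma DR_sig_cat m j x i : wf m x -> reduced m x -> 0 < j <= m.+1 -> 0 < i < m ->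
  DR m.+1 (sig j m.+1 ++ x) i <-> DR m x i.
Proof.
move=> hx hr hj hi; have [hw' hr'] := reduced_sig_cat hx hr hj.
have mono a b : 0 < a <= m -> 0 < b <= m ->
    (wperm (sig j m.+1) a < wperm (sig j m.+1) b) = (a < b).
  by move=> ha hb; rewrite !wperm_sig //; apply/idP/idP; case_ifs; lia.
have h1 := wperm_in (k := i) hx ltac:(lia).
have h2 := wperm_in (k := i.+1) hx ltac:(lia).
rewrite (DR_wperm _ hw' hr') (DR_wperm _ hx hr) !wperm_cat mono //.
by split=> -[]; split=> //; lia.
Qed.

Lemma Mentry_first_col n k : 0 < n -> k < n`! -> Mentry n k 0 = 1.
Proof.
move=> hn hk; have [hx hr] := tau_simple hn hk.
by apply: Mentry1; rewrite tau_first //; exact: normal_nil_r.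
Qed.

Lemma Mentry_last_row n l : 0 < n -> l < n`! -> Mentry n n`!.-1 l = 1.
Proof.
move=> hn hl; have [hy _] := tau_simple hn hl.
by apply: Mentry1; rewrite tau_last //; exact: normal_Delta_l.
Qed.

Lemma Mentry_first_row n l : 0 < n -> 0 < l < n`! -> Mentry n 0 l = 0.
Proof.
move=> hn /andP[hl0 hl]; have [hy _] := tau_simple hn hl.
apply: Mentry0; rewrite tau_first // => /(normal_nil_l hy) e.
by have := size_tau_gt0 hn (introT andP (conj hl0 hl)); rewrite e.
Qed.

Lemma Mentry_last_col n k : 0 < n -> k < n`!.-1 -> Mentry n k n`!.-1 = 0.
Proof.
move=> hn hk; have [hx hr] := tau_simple hn (leq_trans hk (leq_pred _)).
apply: Mentry0; rewrite tau_last // => /(normal_Delta_r hx hr) /beq_size.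
by have := size_tau_lt hn hk; lia.
Qed.

Lemma Mentry_block m q k l : 0 < m -> q < m.+1 -> k < m`! -> l < m`! ->
  Mentry m.+1 (q * m`! + k) l = Mentry m k l.
Proof.
move=> hm hq hk hl; apply: eq_Mentry.
rewrite tau_block // tau_prefix //.
have [hx hr] := tau_simple hm hk; have [hy _] := tau_simple hm hl.
have hj : 0 < m.+1 - q <= m.+1 by lia.
have [hw' hr'] := reduced_sig_cat hx hr hj.
rewrite (normalP hw' (wf_le (leqnSn m) hy) hr') (normalP hx hy hr).
split=> H i hd.
- have [hi _] := DL_ldvd hd.
  exact: (DR_sig_cat hx hr hj hi).1 (H i (DL_widen hd)).
- have hd' := DL_narrow hy hd; have [hi _] := DL_ldvd hd'.
  exact: (DR_sig_cat hx hr hj hi).2 (H i hd').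
Qed.

Lemma Mentry_eq_rows n k k' l : 0 < n -> k < n`! -> k' < n`! -> l < n`! ->
  (forall i, DR n (tau n k) i <-> DR n (tau n k') i) -> Mentry n k l = Mentry n k' l.
Proof.
move=> hn hk hk' hl hDR; apply: eq_Mentry.
rewrite (normal_tauP hn hk hl) (normal_tauP hn hk' hl).
by split=> H i hd; apply/hDR; apply: H.
Qed.

Lemma Mentry_eq_cols n k l l' : 0 < n -> k < n`! -> l < n`! -> l' < n`! ->
  (forall i, DL n (tau n l) i <-> DL n (tau n l') i) -> Mentry n k l = Mentry n k l'.
Proof.
move=> hn hk hl hl' hDL; apply: eq_Mentry.
rewrite (normal_tauP hn hk hl) (normal_tauP hn hk hl').
by split=> H i hd; apply: H; apply/hDL.
Qed.

Unset Implicit Arguments.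

Theorem lemma2p5 (n : nat) (hn : 2 <= n) :
  (* (i) *)
  [/\ (forall k, k < n`! -> Mentry n k 0 = 1),
      (forall l, l < n`! -> Mentry n (n`!.-1) l = 1),
      (forall l, 0 < l < n`! -> Mentry n 0 l = 0) &
      (forall k, k < n`!.-1 -> Mentry n k (n`!.-1) = 0)] /\
  (* (ii) *)
  (forall q k l, q < n -> k < (n.-1)`! -> l < (n.-1)`! ->
     Mentry n (q * (n.-1)`! + k) l = Mentry n.-1 k l) /\
  (* (iii) *)
  (forall k k', k < n`! -> k' < n`! ->
     (forall i, DR n (tau n k) i <-> DR n (tau n k') i) ->
     forall l, l < n`! -> Mentry n k l = Mentry n k' l) /\
  (forall l l', l < n`! -> l' < n`! ->
     (forall i, DL n (tau n l) i <-> DL n (tau n l') i) ->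
     forall k, k < n`! -> Mentry n k l = Mentry n k l').
Proof.
have hn0 : 0 < n by lia.
split; first split.
- by move=> k; exact: Mentry_first_col.
- by move=> l; exact: Mentry_last_row.
- by move=> l; exact: Mentry_first_row.
- by move=> k; exact: Mentry_last_col.
split; first by case: n hn {hn0} => [|[|m]] //= _ q k l; apply: Mentry_block.
split=> [k k' hk hk' hDR l hl | l l' hl hl' hDL k hk].
- exact: Mentry_eq_rows.
- exact: Mentry_eq_cols.
Qed.
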